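(* Let $(t_k)_{k\ge0}$ be a sequence of positive real numbers such that $$\sum_{k=0}^\infty 2^kt_k<1\qquad\text{and}\qquad\sum_{k=0}^\infty 2^k\cdot t_k\cdot k<\infty .$$ Then the symmetric Cantor set $E$ with parameters $(t_k)$ contains an infinite geometric progression with every quotient $q\in(0,1)$; that is, for every $q\in(0,1)$ there exists $a\neq0$ such that $aq^n\in E$ for all integers $n\ge0$.
   Context: Given a sequence $t_0,t_1,\ldots$ of positive reals with $\sum_{k=0}^\infty 2^kt_k\le1$, define sets $E_0\supset E_1\supset\cdots$ inductively, each $E_k$ being the union of $2^k$ disjoint closed intervals of equal length: $E_0=[0,1]$, and $E_{k+1}$ is obtained from $E_k$ by removing an open interval of length $t_k$ from the middle of (i.e. centered in) each of the $2^k$ closed intervals of $E_k$. The condition on $(t_k)$ guarantees that the intervals of $E_k$ have length greater than $t_k$. The set $E=\bigcap_{k=0}^\infty E_k$ is called the symmetric Cantor set with parameters $(t_k)$. *)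

(* Defs.v *)
From mathcomp Require Import all_boot all_order all_algebra.
From mathcomp Require Import all_classical all_reals all_analysis.

Set Implicit Arguments.
Unset Strict Implicit.
Unset Printing Implicit Defensive.

Import Order.TTheory GRing.Theory Num.Theory.

Local Open Scope classical_set_scope.
Local Open Scope ring_scope.

(* A pair J stands for the closed interval `[J.1, J.2].  The two pairs below are
   what is left of it once the open interval of length l with the same center is
   removed, for 0 < l <= J.2 - J.1.  The symmetric Cantor set only uses this with
   l < J.2 - J.1, because t_k > 0 and \sum_k 2^k t_k <= 1. *)
Definition remove_middle (R : realType) (l : R) (J : R * R) : seq (R * R) :=
  [:: (J.1, (J.1 + J.2) / 2 - l / 2); ((J.1 + J.2) / 2 + l / 2, J.2)].

Fixpoint cantor_intervals (R : realType) (t : nat -> R) (k : nat) :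
    seq (R * R) :=
  if k is k'.+1 then
    flatten (map (remove_middle (t k')) (cantor_intervals t k'))
  else [:: (0, 1)].

Definition cantor_stage (R : realType) (t : nat -> R) (k : nat) : set R :=
  \bigcup_(J in [set` cantor_intervals t k]) `[J.1, J.2]%classic.

Definition symmetric_cantor_set (R : realType) (t : nat -> R) : set R :=
  \bigcap_k cantor_stage t k.

(* Main.v *)
Require Import Defs.
From mathcomp Require Import all_boot all_order all_algebra.
From mathcomp Require Import all_classical all_reals all_analysis.
From mathcomp Require Import ring lra.

(** The set E misses very little mass near 0, in the scale-invariant sense that
    matters for geometric progressions.

    Fix q and a small d > 0, and look for a in [qd, d].  Such an a is bad when
    some a q^n falls in a removed gap ]u, u + w[, i.e. when a lies in one of the
    dilates q^-n ]u, u + w[.  Only the dilates with u < d q^n can reach a point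
    a <= d; their lengths w q^-n form a geometric progression whose largest term
    is below w d / u, so one gap spoils a set of a's of measure at most
    d / (1 - q) * (w / u) (lebesgue_measure_dilates_le).  As [qd, d] has length
    d (1 - q), a good a exists as soon as the ratios w / u of the relevant gaps
    add up to less than (1 - q)^2 (exists_progression_avoiding_intervals).

    For the symmetric Cantor set with m = 1 - sum_k 2^k t_k > 0, intervals of
    stage k have length at least m / 2^k, so the gap number i of level k starts
    at (i + 1) m / 2^(k+1) or later.  The ratios w / u over level k are therefore
    bounded by 2^(k+1) t_k / m times a harmonic sum of 2^k terms, which is at most
    k + 1 (sum_gap_ratio_le).  The two hypotheses on t make
    sum_k 2^k t_k (k + 1) converge, so its tail from some K on is small.  With d
    the length of the intervals of stage K, the gaps of level less than K all
    start at d or later and never meet the progression. *)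

Set Implicit Arguments.
Unset Strict Implicit.
Unset Printing Implicit Defensive.

Import Order.TTheory GRing.Theory Num.Theory.
Import numFieldNormedType.Exports.

Local Open Scope classical_set_scope.
Local Open Scope ring_scope.

(** * Intervals and gaps of the construction *)

Fixpoint interval_length (R : realType) (t : nat -> R) (k : nat) : R :=
  if k is k'.+1 then (interval_length t k' - t k') / 2 else 1.

(** The 2^k intervals of stage k are numbered from left to right, so that those
    numbered 2i and 2i+1 at stage k+1 come from the one numbered i at stage k.
    Explicit left endpoints give the bound by i that leads to a harmonic sum. *)
Fixpoint interval_start (R : realType) (t : nat -> R) (k i : nat) : R :=
  if k is k'.+1 then
    interval_start t k' i./2 + (odd i)%:R * (interval_length t k + t k')
  else 0.

Definition gap_start (R : realType) (t : nat -> R) (k i : nat) : R :=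
  interval_start t k i + interval_length t k.+1.

Lemma interval_lengthS (R : realType) (t : nat -> R) k :
  interval_length t k = 2 * interval_length t k.+1 + t k.
Proof. by rewrite /=; field. Qed.

Lemma interval_startS (R : realType) (t : nat -> R) k i :
  interval_start t k.+1 i =
  interval_start t k i./2 + (odd i)%:R * (interval_length t k.+1 + t k).
Proof. by []. Qed.

Lemma half_lt_exp2 k i : (i < 2 ^ k.+1)%N -> (i./2 < 2 ^ k)%N.
Proof. by rewrite expnS mul2n => ik; rewrite ltn_half_double. Qed.

Lemma mem_cantor_intervals (R : realType) (t : nat -> R) k i : (i < 2 ^ k)%N ->
  (interval_start t k i, interval_start t k i + interval_length t k)
    \in cantor_intervals t k.
Proof.
elim: k i => [|k IHk] i ik; first by rewrite /= add0r inE.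
apply/flatten_mapP; exists (interval_start t k i./2,
  interval_start t k i./2 + interval_length t k).
  exact/IHk/half_lt_exp2.
rewrite !inE /= !xpair_eqE; case: (odd i) => /=.
  by apply/orP; right; apply/andP; split; apply/eqP; field.
by apply/orP; left; apply/andP; split; apply/eqP; field.
Qed.

(** By induction on k: a point of an interval outside its middle gap is in one
    of its two children. *)
Lemma exists_interval_of_avoid_gaps (R : realType) (t : nat -> R) (x : R) k :
  0 <= x <= 1 ->
  (forall k i, (i < 2 ^ k)%N ->
     ~ (gap_start t k i < x < gap_start t k i + t k)) ->
  exists2 i, (i < 2 ^ k)%N &
    interval_start t k i <= x <= interval_start t k i + interval_length t k.
Proof.
move=> x01 nogap; elim: k => [|k [i ik xi]].
  by exists 0%N => //=; rewrite add0r.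
have := nogap _ _ ik; rewrite /gap_start.
have := interval_lengthS t k.
set l := interval_length t k in xi *; set l' := interval_length t k.+1.
set s := interval_start t k i in xi * => ll' /negP.
rewrite negb_and -!leNgt => /orP[xs|xs].
- exists i.*2; first by rewrite expnS mul2n ltn_double.
  by rewrite interval_startS odd_double doubleK -/s -/l' mul0r addr0; lra.
- exists i.*2.+1; first by rewrite expnS mul2n ltn_Sdouble.
  rewrite interval_startS /= odd_double uphalf_double -/s.
  by rewrite -[(_ - _) / 2]/l' mul1r; lra.
Qed.

Lemma symmetric_cantor_set_avoid_gaps (R : realType) (t : nat -> R) (x : R) :
  0 <= x <= 1 ->
  (forall k i, (i < 2 ^ k)%N ->
     ~ (gap_start t k i < x < gap_start t k i + t k)) ->
  symmetric_cantor_set t x.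
Proof.
move=> x01 nogap k _.
have [i ik xi] := exists_interval_of_avoid_gaps k x01 nogap.
exists (interval_start t k i, interval_start t k i + interval_length t k).
  exact: mem_cantor_intervals.
by rewrite /= in_itv.
Qed.

(** * Quantitative bounds on lengths and gap positions *)

(** The total length 2^k l_k of stage k is what the removals of total length
    2^j t_j, for j < k, leave of [0, 1]. *)
Lemma interval_length_scaled (R : realType) (t : nat -> R) k :
  2 ^+ k * interval_length t k = 1 - \sum_(j < k) 2 ^+ j * t j.
Proof.
elim: k => [|k IHk]; first by rewrite big_ord0 mul1r subr0.
rewrite big_ord_recr /= opprD addrA -IHk exprS.
by field.
Qed.

(** The i intervals to the left of the i-th one are disjoint. *)
Lemma interval_start_ge (R : realType) (t : nat -> R) k i :
  (forall k, 0 <= t k) -> (i < 2 ^ k)%N ->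
  i%:R * interval_length t k <= interval_start t k i.
Proof.
move=> t0; elim: k i => [|k IHk] i ik; first by case: i ik => //; rewrite mul0r.
have := IHk _ (half_lt_exp2 ik); rewrite (interval_lengthS t k).
have := t0 k.
have -> : i%:R = (odd i)%:R + 2 * i./2%:R :> R.
  by rewrite -{1}(odd_double_half i) natrD -mul2n natrM.
rewrite interval_startS; set l := interval_length t k.+1 => tk h.
have i0 : 0 <= i./2%:R :> R := ler0n _ _.
have := mulr_ge0 i0 tk.
by case: (odd i) => /=; lra.
Qed.

(** Dyadic blocks: each of the 2^k new terms at step k is at most 1 / 2^k. *)
Lemma sum_inv_exp2_le (R : realType) k :
  \sum_(i < 2 ^ k) (i.+1%:R : R)^-1 <= k.+1%:R.
Proof.
elim: k => [|k IHk]; first by rewrite big_ord1 invr1.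
rewrite expnS mul2n -addnn big_split_ord /= -[k.+2]addn1 natrD lerD//.
apply: (@le_trans _ _ (\sum_(i < 2 ^ k) ((2 ^ k)%:R : R)^-1)).
  apply: ler_sum => i _; rewrite lef_pV2 ?posrE ?ltr0n ?expn_gt0//.
  by rewrite ler_nat -addnS leq_addr.
by rewrite sumr_const card_ord -[leLHS]mulr_natr mulVf// pnatr_eq0 expn_eq0.
Qed.

Lemma interval_length_ge (R : realType) (t : nat -> R) (m : R) k :
  (forall k, \sum_(j < k) 2 ^+ j * t j <= 1 - m) ->
  m / 2 ^+ k <= interval_length t k.
Proof.
move=> tm; rewrite ler_pdivrMr ?exprn_gt0// mulrC interval_length_scaled.
by have := tm k; lra.
Qed.

Lemma gap_start_ge (R : realType) (t : nat -> R) k i :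
  (forall k, 0 <= t k) -> 0 <= interval_length t k.+1 -> (i < 2 ^ k)%N ->
  i.+1%:R * interval_length t k.+1 <= gap_start t k i.
Proof.
move=> t0 l0 ik; rewrite /gap_start -natr1 mulrDl mul1r lerD2r.
apply: le_trans (interval_start_ge t0 ik); rewrite ler_wpM2l//.
by rewrite (interval_lengthS t k); have := t0 k; lra.
Qed.

(** The logarithmic weight k + 1 of level k is the harmonic sum that appears
    because its 2^k gaps start at multiples of about 1 / 2^k. *)
Lemma sum_gap_ratio_le (R : realType) (t : nat -> R) (m : R) k :
  (forall k, 0 <= t k) -> 0 < m ->
  (forall k, \sum_(j < k) 2 ^+ j * t j <= 1 - m) ->
  \sum_(i < 2 ^ k) t k / gap_start t k i <=
    2 / m * (2 ^+ k * t k * k%:R + 2 ^+ k * t k).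
Proof.
move=> t0 m0 tm.
have -> : 2 / m * (2 ^+ k * t k * k%:R + 2 ^+ k * t k) =
    t k * (2 ^+ k.+1 / m) * k.+1%:R.
  by rewrite -natr1 exprS; field; rewrite gt_eqF.
apply: (@le_trans _ _ (t k * (2 ^+ k.+1 / m) * \sum_(i < 2 ^ k) i.+1%:R^-1)).
  rewrite mulr_sumr; apply: ler_sum => i _; rewrite -mulrA ler_wpM2l//.
  have lm : 0 < m / 2 ^+ k.+1 by rewrite divr_gt0// exprn_gt0.
  have ml := interval_length_ge k.+1 tm.
  have gs := gap_start_ge t0 (le_trans (ltW lm) ml) (ltn_ord i).
  have ig : m / 2 ^+ k.+1 * i.+1%:R <= gap_start t k i.
    by apply: le_trans gs; rewrite mulrC ler_wpM2l.
  have ml0 : 0 < m / 2 ^+ k.+1 * i.+1%:R by rewrite mulr_gt0.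
  rewrite -[2 ^+ _ / m]invf_div -invfM lef_pV2 ?posrE//.
  exact: lt_le_trans ig.
by rewrite ler_wpM2l ?sum_inv_exp2_le// mulr_ge0// divr_ge0 ?exprn_ge0// ltW.
Qed.

(** * Dilates of an interval and geometric progressions *)

Lemma sum_inv_powers (R : realType) (q : R) n : q != 0 ->
  (1 - q) * \sum_(i < n.+1) q^-1 ^+ i = q^-1 ^+ n - q.
Proof.
move=> q0; elim: n => [|n IHn]; first by rewrite big_ord1 expr0 mulr1.
by rewrite big_ord_recr mulrDr IHn /= exprS; field.
Qed.

(** The union is cut to the exponents n with u < d q^n, which are the only ones
    for which the dilate by q^-n reaches below d; this makes it a finite union
    although it still catches every a <= d with some a q^n in ]u, v[. *)
Definition dilates (R : realType) (q d u v : R) : set R :=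
  \bigcup_(n in [set n | u < d * q ^+ n])
    `]u * q^-1 ^+ n, v * q^-1 ^+ n[%classic.

Lemma measurable_dilates (R : realType) (q d u v : R) :
  measurable (dilates q d u v).
Proof. by apply: bigcup_measurable => n _; exact: measurable_itv. Qed.

Lemma mem_dilates (R : realType) (q d u v a : R) n : 0 < q -> a <= d ->
  u < a * q ^+ n < v -> dilates q d u v a.
Proof.
move=> q0 ad /andP[ua av]; exists n.
  by apply: lt_le_trans ua _; rewrite ler_pM2r// exprn_gt0.
by rewrite /= in_itv /= exprVn ltr_pdivrMr ?exprn_gt0// ua ltr_pdivlMr ?exprn_gt0.
Qed.

Lemma dilates_eq0 (R : realType) (q d u v : R) : 0 < q < 1 -> 0 <= d -> d <= u ->
  dilates q d u v = set0.
Proof.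
move=> /andP[q0 q1] d0 du; apply/seteqP; split=> // x [n /=] + _.
apply/negP; rewrite -leNgt; apply: le_trans du.
by rewrite ler_piMr// exprn_ile1 ?ltW.
Qed.

(** The largest relevant exponent M satisfies q^-M < d / u, and summing the
    geometric progression downwards from q^-M costs only a factor 1 / (1 - q). *)
Lemma lebesgue_measure_dilates_le (R : realType) (q d u v : R) : 0 < q < 1 ->
  0 < d -> 0 < u -> u <= v ->
  (lebesgue_measure (dilates q d u v) <= (d / (1 - q) * ((v - u) / u))%:E)%E.
Proof.
move=> q01 d0 u0 uv; have /andP[q0 q1] := q01.
have Q n : 0 < q^-1 ^+ n by rewrite exprn_gt0// invr_gt0.
have [du|ud] := leP d u.
  rewrite (dilates_eq0 _ q01 (ltW d0) du) measure0 lee_fin.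
  by apply: mulr_ge0; apply: divr_ge0; rewrite ?subr_ge0// ltW.
have exM : exists M, d * q ^+ M <= u.
  have /cvg_expr/cvgr0_norm_lt : `|q| < 1 by rewrite ger0_norm// ltW.
  move=> /(_ (u / d) (divr_gt0 u0 d0))[M _ /(_ M (leqnn M))] /=.
  rewrite ger0_norm ?exprn_ge0 ?(ltW q0)// ltr_pdivlMr// mulrC => /ltW ?.
  by exists M.
case: (ex_minnP exM) => -[|M dqM Mmin]; first by rewrite expr0 mulr1 leNgt ud.
have udM : u < d * q ^+ M by rewrite ltNge; apply/negP => /Mmin; rewrite ltnn.
pose I n : set R := `]u * q^-1 ^+ n, v * q^-1 ^+ n[%classic.
have cover : (lebesgue_measure (dilates q d u v) <=
    \sum_(n < M.+1) lebesgue_measure (I n))%E.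
  apply: (@content_subadditive _ _ _ (@lebesgue_measure R) _ I).
  - by move=> n _; exact: measurable_itv.
  - exact: measurable_dilates.
  - rewrite -bigcup_mkord => x [n /= un xn]; exists n => //=.
    rewrite ltnNge; apply/negP => Mn; move: un; apply/negP; rewrite -leNgt.
    apply: le_trans dqM; rewrite ler_pM2l//.
    by rewrite ler_wiXn2l ?ltW.
apply: (le_trans cover).
have measI n : (lebesgue_measure (I n) = ((v - u) * q^-1 ^+ n)%:E)%E.
  rewrite lebesgue_measure_itv /= lte_fin ltr_pM2r//.
  case: ltgtP uv => // [_ _|-> _]; first by rewrite -EFinB mulrBl.
  by rewrite subrr mul0r.
rewrite (eq_bigr (fun n : 'I_M.+1 => ((v - u) * q^-1 ^+ n)%:E)); last first.
  by move=> n _; exact: measI.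
rewrite sumEFin lee_fin -mulr_sumr.
have -> : d / (1 - q) * ((v - u) / u) = (v - u) * (d / u / (1 - q)).
  by field; apply/andP; split; rewrite lt0r_neq0// subr_gt0.
rewrite ler_wpM2l ?subr_ge0// ler_pdivlMr ?subr_gt0// mulrC.
rewrite sum_inv_powers ?gt_eqF//.
have : q^-1 ^+ M < d / u.
  by rewrite exprVn ltr_pdivlMr// mulrC ltr_pdivrMr// exprn_gt0.
by move/ltW; apply: le_trans; rewrite gerBl ltW.
Qed.

(** A union bound: the bad a's have measure less than d (1 - q), the length of
    [qd, d].  The smallness hypothesis does not involve d, because the ratio
    w / u is invariant under scaling; this lets d be chosen after K. *)
Lemma exists_progression_avoiding_intervals (R : realType)
  (u w : nat -> nat -> R) (N : nat -> nat) (q d : R) (K : nat) :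
  0 < q < 1 -> 0 < d ->
  (forall k i, (i < N k)%N -> 0 < u k i) ->
  (forall k i, 0 <= w k i) ->
  (\sum_(K <= k <oo) (\sum_(i < N k) w k i / u k i)%:E < ((1 - q) ^+ 2)%:E)%E ->
  exists2 a, q * d <= a <= d & forall k i n, (K <= k)%N -> (i < N k)%N ->
    ~ (u k i < a * q ^+ n < u k i + w k i).
Proof.
move=> q01 d0 u0 w0 small; have /andP[q0 q1] := q01.
pose bad k := \big[setU/set0]_(i < N k) dilates q d (u k i) (u k i + w k i).
have mbad k : measurable (bad k).
  by apply: bigsetU_measurable => i _; exact: measurable_dilates.
have bad_le k : (lebesgue_measure (bad k) <=
    (d / (1 - q))%:E * (\sum_(i < N k) w k i / u k i)%:E)%E.
  apply: (@le_trans _ _ (\sum_(i < N k)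
      lebesgue_measure (dilates q d (u k i) (u k i + w k i)))%E).
    apply: (@content_subadditive _ _ _ (@lebesgue_measure R) _
      (fun i => dilates q d (u k i) (u k i + w k i))) => //.
    - by move=> i _; exact: measurable_dilates.
    - exact: mbad.
  rewrite -EFinM mulr_sumr -sumEFin; apply: lee_sum => i _.
  have := lebesgue_measure_dilates_le q01 d0 (u0 k i (ltn_ord i)).
  by move=> /(_ (u k i + w k i)); rewrite lerDl addrAC subrr add0r; exact.
apply: contrapT => nogood.
pose J : set R := `[q * d, d]%classic.
have cover : J `<=` \bigcup_(k in ~` `I_K) bad k.
  move=> a; rewrite /J /= in_itv /= => /andP[qda ad]; apply: contrapT => abad.
  apply: nogood; exists a; first by rewrite qda.
  move=> k i n Kk iN gap; apply: abad; exists k; first by apply/negP; rewrite -leqNgt.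
  rewrite /bad -(bigcup_mkord _ (fun i => dilates q d (u k i) (u k i + w k i))).
  exists i => //.
  exact: mem_dilates gap.
have : (lebesgue_measure J <= \sum_(K <= k <oo) lebesgue_measure (bad k))%E.
  exact: (measure_sigma_subadditive_tail (@lebesgue_measure R) mbad
    (measurable_itv _) cover).
apply/negP; rewrite -ltNge.
have dq0 : 0 < d / (1 - q) by rewrite divr_gt0// subr_gt0.
apply: (@le_lt_trans _ _ (\sum_(K <= k <oo)
   (d / (1 - q))%:E * (\sum_(i < N k) w k i / u k i)%:E)%E).
  by apply: lee_nneseries => [k _ _|k _]; [exact: measure_ge0|exact: bad_le].
have s0 k : (0 <= (\sum_(i < N k) w k i / u k i)%:E)%E.
  rewrite lee_fin sumr_ge0// => i _.
  by apply: divr_ge0 => //; rewrite ltW// u0.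
rewrite nneseriesZl// /J.
rewrite lebesgue_measure_itv /= lte_fin gtr_pMl// q1 -EFinB.
have -> : d - q * d = d / (1 - q) * (1 - q) ^+ 2.
  by field; rewrite lt0r_neq0// subr_gt0.
by rewrite [ltRHS]EFinM lte_pmul2l.
Qed.

(** * Geometric progressions in symmetric Cantor sets *)

Theorem corollary4p4 (R : realType) (t : nat -> R)
  (t_gt0 : forall k : nat, 0 < t k)
  (sum_lt1 : (\sum_(0 <= k <oo) (2 ^+ k * t k)%:E < 1)%E)
  (sum_k_fin : (\sum_(0 <= k <oo) (2 ^+ k * t k * k%:R)%:E < +oo)%E) :
  forall q : R, 0 < q < 1 ->
    exists a : R, a != 0 /\
      forall n : nat, symmetric_cantor_set t (a * q ^+ n).
Proof.
move=> q q01; have /andP[q0 q1] := q01.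
have t0 k : 0 <= t k by rewrite ltW.
have a0 k : (0 <= (2 ^+ k * t k)%:E)%E by rewrite lee_fin mulr_ge0// exprn_ge0.
have ak0 k : (0 <= (2 ^+ k * t k * k%:R)%:E)%E.
  by rewrite lee_fin mulr_ge0// mulr_ge0// exprn_ge0.
have [m m0 tm] : exists2 m : R, 0 < m &
    forall k, \sum_(j < k) 2 ^+ j * t j <= 1 - m.
  have s0 : (0 <= \sum_(0 <= k <oo) (2 ^+ k * t k)%:E)%E by exact: nneseries_ge0.
  have psum k : (\sum_(0 <= j < k) (2 ^+ j * t j)%:E <=
      \sum_(0 <= k <oo) (2 ^+ k * t k)%:E)%E by exact: nneseries_lim_ge.
  move: sum_lt1 s0 psum; case: (limn _) => // S S1 _ psum.
  exists (1 - S); first by rewrite subr_gt0 -lte_fin.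
  by move=> k; have := psum k; rewrite big_mkord sumEFin lee_fin; lra.
pose c k := 2 / m * (2 ^+ k * t k * k%:R + 2 ^+ k * t k).
have c0 k : (0 <= (c k)%:E)%E.
  rewrite lee_fin mulr_ge0 ?divr_ge0 ?(ltW m0)//.
  by rewrite addr_ge0// -lee_fin.
have sum_c : (\sum_(0 <= k <oo) (c k)%:E < +oo)%E.
  under eq_eseriesr do rewrite /c EFinM EFinD.
  rewrite nneseriesZl => [|k _]; last by rewrite adde_ge0.
  rewrite nneseriesD// lte_mul_pinfty ?lee_fin ?divr_ge0 ?(ltW m0)//.
  by rewrite lte_add_pinfty// (lt_trans sum_lt1) ?ltry.
have [K tailK] : exists K, (\sum_(K <= k <oo) (c k)%:E < ((1 - q) ^+ 2)%:E)%E.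
  have e0 : (0 < ((1 - q) ^+ 2)%:E)%E by rewrite lte_fin exprn_gt0// subr_gt0.
  have := nneseries_tail_cvg sum_c (fun k _ => c0 k).
  by move=> /(_ _ (open_ereal_lt' e0))[K _ /(_ K (leqnn K))]; exists K.
have l0 k : 0 < interval_length t k.
  by apply: lt_le_trans (interval_length_ge k tm); rewrite divr_gt0// exprn_gt0.
have l_dec k : interval_length t k.+1 <= interval_length t k.
  by rewrite (interval_lengthS t k); have := t0 k; have := l0 k.+1; lra.
have gap0 k i : (i < 2 ^ k)%N -> interval_length t k.+1 <= gap_start t k i.
  move=> ik; apply: le_trans (gap_start_ge t0 (ltW (l0 _)) ik).
  by rewrite ler_peMl ?ler1n// ltW.
have small : (\sum_(K <= k <oo) (\sum_(i < 2 ^ k) t k / gap_start t k i)%:E <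
    ((1 - q) ^+ 2)%:E)%E.
  apply: le_lt_trans tailK; apply: lee_nneseries => [k _ _|k _].
    rewrite lee_fin sumr_ge0// => i _; rewrite divr_ge0//.
    by rewrite (le_trans (ltW (l0 k.+1)))// gap0.
  by rewrite lee_fin; exact: sum_gap_ratio_le.
have [a /andP[qda ad] avoid] := exists_progression_avoiding_intervals q01 (l0 K)
  (fun k i ik => lt_le_trans (l0 _) (gap0 k i ik)) (fun k _ => t0 k) small.
have a_gt0 : 0 < a by apply: lt_le_trans qda; rewrite mulr_gt0.
exists a; split=> [|n]; first by rewrite gt_eqF.
have aqn : a * q ^+ n <= interval_length t K.
  by apply: le_trans ad; rewrite ler_piMr ?exprn_ile1 ?(ltW a_gt0)// ltW.
have /nonincreasing_seqP l_le := l_dec.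
apply: symmetric_cantor_set_avoid_gaps.
  rewrite mulr_ge0 ?exprn_ge0 ?(ltW a_gt0) ?(ltW q0)//=.
  exact: le_trans aqn (l_le _ _ (leq0n K)).
(* A gap of level k < K starts at l_(k+1) >= l_K or later, beyond a q^n. *)
move=> k i ik; have [Kk|kK] := leqP K k; first exact: avoid.
move=> /andP[+ _]; apply/negP; rewrite -leNgt; apply: le_trans aqn _.
exact: le_trans (l_le _ _ kK) (gap0 _ _ ik).
Qed.
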